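(* Let $M$ be a $d\times d$ dilation matrix and let $t\in\mathcal{Z}^1$. If $t_{jk}$, $j,k=1,\dots,d$, are any trigonometric polynomials such that for every $k=1,\dots,d$ $$(1-e^{2\pi i(x,\mathbf{e}_k)})\,t(x)=\sum_{j=1}^d t_{jk}(x)\,(1-e^{2\pi i(M^*x,\mathbf{e}_j)}),$$ then $t_{jk}\in\mathcal{Z}^0$ for all $j,k=1,\dots,d$.
   Context: A dilation matrix $M$ is a non-degenerate $d\times d$ integer matrix all of whose eigenvalues are larger than $1$ in modulus; $M^*$ is its transpose. $\mathbf{e}_j$ is the $j$-th unit vector of $\mathbb{R}^d$, $(\cdot,\cdot)$ is the standard inner product. A trigonometric polynomial is a function $t(x)=\sum_{n\in\mathbb{Z}^d}\widehat t(n)e^{2\pi i(n,x)}$, $x\in\mathbb{R}^d$, with only finitely many non-zero coefficients. $D(M^* )$ is a set of representatives (digits) of the cosets $\mathbb{Z}^d/M^*\mathbb{Z}^d$, containing $\mathbf{0}$. For an integer $n\ge0$, $\mathcal{Z}^n$ is the set of trigonometric polynomials $t$ such that $D^\beta\big[t({M^*}^{-1}x)\big]\big|_{x=s}=0$ for all $s\in D(M^* )$, $s\ne\mathbf{0}$, and all multi-indices $\beta\in\mathbb{Z}_+^d$ with $[\beta]:=\beta_1+\dots+\beta_d\le n$. *)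

(* Defs.v *)
From HB Require Import structures.
From mathcomp Require Import all_boot all_order all_algebra.
From mathcomp Require Import complex.
From mathcomp Require Import all_classical all_reals all_analysis.

Set Implicit Arguments.
Unset Strict Implicit.
Unset Printing Implicit Defensive.

Import Order.TTheory GRing.Theory Num.Theory.
Import numFieldNormedType.Exports.

Local Open Scope classical_set_scope.
Local Open Scope ring_scope.

(* Vectors of R^d and Z^d are columns; integer vectors and matrices are sent to
   any ring through [castz]. *)
Notation castz := (map_mx intr).

Section TrigPoly.
Variables (R : realType) (d : nat).
Implicit Types (x y : 'cV[R]_d) (f t : 'cV[R]_d -> R[i]).

Definition inner x y : R := \sum_(i < d) x i 0 * y i 0.

Definition unitvec (j : 'I_d) : 'cV[R]_d := delta_mx j 0.

(* e^{2 pi i u} for real u *)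
Definition e2pii (u : R) : R[i] :=
  (cos (2 * pi * u) +i* sin (2 * pi * u))%C.

Definition trigpoly t : Prop :=
  exists that : 'cV[int]_d -> R[i],
    finite_set [set n | that n != 0] /\
    forall x, t x = \sum_(n \in [set: 'cV[int]_d])
                      that n * e2pii (inner (castz n) x).

(* R[i] carries no normed R-module structure in the library, so the derivative
   of a C-valued function of real variables is taken on real and imaginary
   parts. *)
Definition cpartial (j : 'I_d) f : 'cV[R]_d -> R[i] := fun x =>
  ('D_(unitvec j) (fun y => complex.Re (f y)) x
   +i* 'D_(unitvec j) (fun y => complex.Im (f y)) x)%C.

(* D^beta = d_0^(beta 0) d_1^(beta 1) ... d_(d-1)^(beta (d-1)) *)
Definition multiderive (beta : 'I_d -> nat) f : 'cV[R]_d -> R[i] :=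
  foldr (fun j g => iter (beta j) (cpartial j) g) f (enum 'I_d).

Definition dilation (M : 'M[int]_d) : Prop :=
  \det M != 0 /\
  forall a : R[i], eigenvalue (castz M : 'M[R[i]]_d) a -> 1 < `|a|.

(* D contains 0 and meets every coset of A Z^d in Z^d in exactly one point. *)
Definition digits (A : 'M[int]_d) (D : set 'cV[int]_d) : Prop :=
  D 0 /\
  forall n : 'cV[int]_d,
    exists! s, D s /\ exists m : 'cV[int]_d, n = s + A *m m.

(* The class Z^n; D stands for D(M^* ). *)
Definition classZ (M : 'M[int]_d) (D : set 'cV[int]_d) (n : nat) :
    set ('cV[R]_d -> R[i]) :=
  [set t | trigpoly t /\
    forall s, D s -> s != 0 ->
    forall beta : 'I_d -> nat, (\sum_(j < d) beta j <= n)%N ->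
      multiderive beta (fun x => t (invmx (castz M^T) *m x)) (castz s) = 0].

End TrigPoly.

(* Main.v *)
Require Import Defs.
From HB Require Import structures.
From mathcomp Require Import all_boot all_order all_algebra.
From mathcomp Require Import complex.
From mathcomp Require Import all_classical all_reals all_analysis.
From mathcomp Require Import ring.
Import Order.TTheory GRing.Theory Num.Theory.
Import numFieldNormedType.Exports.
Local Open Scope classical_set_scope.
Local Open Scope ring_scope.

(** Put [y = M^* x] in the [k]-th identity, so that with [B] the inverse of [M^*]
it reads

  [(1 - e(B y)_k) t(B y) = \sum_j t_jk(B y) (1 - e(y_j))],  [e(u) = exp(2 pi i u)].

At an integer point [y = s] every factor [1 - e(y_j)] vanishes, so the partial
derivative in [y_l] of the right-hand side at [s] loses all the terms that
contain derivatives of the [t_jk]; of the factors [1 - e(y_j)], only the one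
with [j = l] depends on [y_l], and its derivative at [s] is [- 2 pi i].  The
derivative of the right-hand side is thus [- 2 pi i * t_lk(B s)].  When [s] is a
nonzero digit and [t] is in [Z^1], the function [t(B y)] vanishes at [s] together
with its partial derivatives, hence so does its product with any differentiable
function, and the derivative of the left-hand side is [0].  Therefore
[t_lk(B s) = 0], which is what membership in [Z^0] requires.  This is
[coef_eq0_of_double_zero].

The product rule needs actual differentiability, whereas [cpartial] is a total
operator that has a value at every function.  The predicate [is_cderive] below
records both existence and value of a directional derivative; trigonometric
polynomials have one everywhere ([trigpoly_derivable]), which turns the
hypothesis on [cpartial] into a usable one. *)

(** * Derivatives along lines *)

Section LineRestriction.
Set Implicit Arguments.
Unset Strict Implicit.
Variables (R : realType) (V : normedModType R).

Lemma is_derive_line (f : V -> R) (x v : V) (c : R) :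
  is_derive (0 : R) 1 (fun h : R => f (h *: v + x)) c -> is_derive x v f c.
Proof.
case=> dg gc; apply: DeriveDef; first by apply/derivable1P; exact: dg.
rewrite -gc /derive.
set F := (X in lim (X @ _)); set G := (X in _ = lim (X @ _)).
suff -> : F = G by [].
by apply/funext => h; rewrite /F /G /= addr0 scale0r add0r [h *: 1]mulr1.
Qed.

(** A chain rule in which the inner function only has to be affine on the line
through [x] in the direction [v]; it reduces to the one-variable chain rule
because a directional derivative sees only that line. *)
Lemma is_derive_comp_affine (phi : R -> R) (L : V -> R) (x v : V) (b c : R) :
  (forall h : R, L (h *: v + x) = b * h + L x) ->
  is_derive (L x) 1 phi c -> is_derive x v (phi \o L) (c * b).
Proof.
move=> Lline dphi; apply: is_derive_line.
pose aff (h : R) : R := b * h + L x.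
have -> : (fun h : R => (phi \o L) (h *: v + x)) = phi \o aff.
  by apply/funext => h /=; rewrite Lline.
apply: is_derive1_comp; first by rewrite /aff mulr0 add0r.
have -> : aff = b \*: id + cst (L x) by [].
by apply: is_derive_eq; rewrite [b *: 1]mulr1 addr0.
Qed.

End LineRestriction.

(** * Directional derivatives of complex-valued functions *)

Section ComplexDerivative.
Set Implicit Arguments.
Unset Strict Implicit.
Variables (R : realType) (d : nat).
Implicit Types (x v : 'cV[R]_d) (f g : 'cV[R]_d -> R[i]) (a c : R[i]).

Definition is_cderive x v f c : Prop :=
  is_derive x v (fun y => complex.Re (f y)) (complex.Re c) /\
  is_derive x v (fun y => complex.Im (f y)) (complex.Im c).

Lemma is_cderive_unique x v f c c' :
  is_cderive x v f c -> is_cderive x v f c' -> c = c'.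
Proof.
move=> [[_ re] [_ im]] [[_ re'] [_ im']].
by apply/eqP; rewrite eq_complex -re -im re' im' !eqxx.
Qed.

Lemma is_cderive_cst x v a : is_cderive x v (fun=> a) 0.
Proof. by split; apply: is_derive_cst. Qed.

Lemma is_cderiveD x v f g c c' : is_cderive x v f c -> is_cderive x v g c' ->
  is_cderive x v (fun y => f y + g y) (c + c').
Proof.
move=> [f1 f2] [g1 g2]; split.
- have := is_deriveD f1 g1; congr is_derive.
    by apply/funext => y; rewrite fctE; case: (f y) (g y) => ? ? [? ?].
  by case: c c' {f1 f2 g1 g2} => ? ? [? ?].
- have := is_deriveD f2 g2; congr is_derive.
    by apply/funext => y; rewrite fctE; case: (f y) (g y) => ? ? [? ?].
  by case: c c' {f1 f2 g1 g2} => ? ? [? ?].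
Qed.

Lemma is_cderiveM x v f g c c' : is_cderive x v f c -> is_cderive x v g c' ->
  is_cderive x v (fun y => f y * g y) (f x * c' + g x * c).
Proof.
move=> [f1 f2] [g1 g2]; split.
- have := is_deriveB (is_deriveM f1 g1) (is_deriveM f2 g2); congr is_derive.
    by apply/funext => y; rewrite !fctE; case: (f y) (g y) => ? ? [? ?].
  case: (f x) (g x) c c' {f1 f2 g1 g2} => ? ? [? ?] [? ?] [? ?] /=.
  by rewrite /GRing.scale /=; ring.
- have := is_deriveD (is_deriveM f1 g2) (is_deriveM f2 g1); congr is_derive.
    by apply/funext => y; rewrite !fctE; case: (f y) (g y) => ? ? [? ?] /=; ring.
  case: (f x) (g x) c c' {f1 f2 g1 g2} => ? ? [? ?] [? ?] [? ?] /=.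
  by rewrite /GRing.scale /=; ring.
Qed.

Lemma is_cderive_sum (I : Type) (r : seq I) x v (F : I -> 'cV[R]_d -> R[i])
    (c : I -> R[i]) :
  (forall i, is_cderive x v (F i) (c i)) ->
  is_cderive x v (fun y => \sum_(i <- r) F i y) (\sum_(i <- r) c i).
Proof.
move=> dF; elim: r => [|i r IHr].
  rewrite big_nil (_ : (fun _ => _) = fun=> 0); last first.
    by apply/funext => y; rewrite big_nil.
  exact: is_cderive_cst.
rewrite big_cons (_ : (fun _ => _) = fun y => F i y + \sum_(j <- r) F j y).
  exact: is_cderiveD.
by apply/funext => y; rewrite big_cons.
Qed.

Lemma is_cderive_e2pii x v (L : 'cV[R]_d -> R) (b : R) :
  (forall h : R, L (h *: v + x) = b * h + L x) ->
  is_cderive x v (fun y => e2pii (L y)) (e2pii (L x) * (0 +i* (2 * pi * b))%C).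
Proof.
move=> Lline.
have L2 h : 2 * pi * L (h *: v + x) = 2 * pi * b * h + 2 * pi * L x.
  by rewrite Lline; ring.
split.
- have := is_derive_comp_affine (phi := cos) (L := fun y => 2 * pi * L y)
    L2 (is_derive_cos _).
  by congr is_derive => /=; ring.
- have := is_derive_comp_affine (phi := sin) (L := fun y => 2 * pi * L y)
    L2 (is_derive_sin _).
  by congr is_derive => /=; ring.
Qed.

Lemma is_cderive_cpartial (j : 'I_d) x f c :
  is_cderive x (unitvec R j) f c -> cpartial j f x = c.
Proof. by case=> [[_ re] [_ im]]; rewrite /cpartial re im; case: c {re im}. Qed.

(** * Trigonometric polynomials *)

Lemma innerC x y : inner x y = inner y x.
Proof. by apply: eq_bigr => i _; rewrite mulrC. Qed.

Lemma innerDr x y z : inner x (y + z) = inner x y + inner x z.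
Proof.
by rewrite /inner -big_split; apply: eq_bigr => i _; rewrite mxE mulrDr.
Qed.

Lemma innerZr (h : R) x y : inner x (h *: y) = h * inner x y.
Proof.
by rewrite /inner big_distrr; apply: eq_bigr => i _; rewrite mxE /= mulrCA.
Qed.

Lemma inner_unitvec x (k : 'I_d) : inner x (unitvec R k) = x k 0.
Proof.
rewrite /inner (bigD1 k) //= big1 ?addr0 => [|i /negbTE ik].
  by rewrite mxE !eqxx mulr1.
by rewrite mxE ik mulr0.
Qed.

(** Only the existence of the derivative matters: where it is used, either its
value is given by a hypothesis or its coefficient is zero. *)
Lemma trigpoly_derivable (B : 'M[R]_d) f x v : trigpoly f ->
  exists c, is_cderive x v (fun y => f (B *m y)) c.
Proof.
case=> that [fin fE].
pose r := finmap.enum_fset (fset_set [set n | that n != 0]).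
exists (\sum_(n <- r) (that n * (e2pii (inner (castz n) (B *m x)) *
   (0 +i* (2 * pi * inner (castz n) (B *m v)))%C) +
   e2pii (inner (castz n) (B *m x)) * 0)).
have -> : (fun y => f (B *m y)) = fun y =>
    \sum_(n <- r) that n * e2pii (inner (castz n) (B *m y)).
  apply/funext => y; rewrite fE.
  apply: fsbigTE => n; rewrite in_fset_set // notin_setE /= => /negP.
  by rewrite negbK => /eqP ->; rewrite mul0r.
apply: is_cderive_sum => n.
apply: is_cderiveM; first exact: is_cderive_cst.
apply: is_cderive_e2pii => h.
by rewrite mulmxDr -scalemxAr innerDr innerZr mulrC.
Qed.

Lemma e2pii_int (n : int) : e2pii (n%:~R : R) = 1.
Proof.
have nat_case (m : nat) :
    cos (2 * pi * m%:R) = 1 :> R /\ sin (2 * pi * m%:R) = 0 :> R.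
  have -> : 2 * pi * m%:R = 0 + pi *+ 2 *+ m :> R.
    by rewrite add0r -[RHS]mulr_natr -[pi *+ 2]mulr_natl.
  by rewrite (periodicn (@cosD2pi R)) (periodicn (@sinD2pi R)) cos0 sin0.
rewrite /e2pii; case: n => m.
  by have [-> ->] := nat_case m.
have [c1 s0] := nat_case m.+1.
by rewrite NegzE mulrNz mulrN cosN sinN c1 s0 oppr0.
Qed.

(** * Multi-indices of order at most one *)

Lemma multiderive0 f : multiderive (fun=> 0%N) f = f.
Proof. by rewrite /multiderive; elim: (enum 'I_d). Qed.

Lemma multiderive1 (l : 'I_d) f :
  multiderive (fun j => (j == l)%N) f = cpartial l f.
Proof.
rewrite /multiderive.
suff: forall s : seq 'I_d, uniq s ->
    foldr (fun j g => iter (j == l) (cpartial j) g) f s =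
    if l \in s then cpartial l f else f.
  by move=> /(_ _ (enum_uniq _)) ->; rewrite mem_enum.
(* Each coordinate is enumerated once, so only one factor of the fold acts. *)
elim=> //= i s IHs /andP[is_ us]; rewrite IHs // inE (eq_sym l).
by case: eqP => [il|] //=; rewrite -il (negbTE is_).
Qed.

End ComplexDerivative.

(** * Comparing derivatives at an integer point *)

Section DivisionByPeriods.
Set Implicit Arguments.
Unset Strict Implicit.
Variables (R : realType) (d : nat).

(** Both sides of the identity are differentiated along [e_l] at the integer
point [s].  On the left the product has a double zero in that direction, so the
derivative is [0]; on the right it is [- 2 pi i] times the [l]-th coefficient,
because all the factors [1 - e(y_j)] vanish at [s] and only the [l]-th of them
varies along [e_l]. *)
Lemma coef_eq0_of_double_zero (B : 'M[R]_d) (t : 'cV[R]_d -> R[i])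
    (S : 'I_d -> 'cV[R]_d -> R[i]) (w : 'cV[R]_d) (s : 'cV[int]_d) (l : 'I_d) :
  trigpoly t -> (forall j, trigpoly (S j)) ->
  (forall y, (1 - e2pii (inner w (B *m y))) * t (B *m y) =
     \sum_(j < d) S j (B *m y) * (1 - e2pii (y j 0))) ->
  t (B *m castz s) = 0 ->
  cpartial l (fun y => t (B *m y)) (castz s) = 0 ->
  S l (B *m castz s) = 0.
Proof.
move=> tt tS eqS ts0 dts0.
pose x : 'cV[R]_d := castz s; pose v := unitvec R l.
(* [1 - e(u)] has the derivative [- 2 pi i u' e(u)]. *)
have d1e (u : 'cV[R]_d -> R) b : (forall h : R, u (h *: v + x) = b * h + u x) ->
    is_cderive x v (fun y => 1 - e2pii (u y))
      (- (e2pii (u x) * (0 +i* (2 * pi * b))%C)).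
  move=> /is_cderive_e2pii du.
  have := is_cderiveD (is_cderive_cst x v 1)
    (is_cderiveM (is_cderive_cst x v (-1)) du).
  rewrite mulr0 addr0 add0r mulN1r; congr is_cderive.
  by apply/funext => y; rewrite mulN1r.
have [ct dt] := trigpoly_derivable B x v tt.
(* Since the derivative exists, the hypothesis on [cpartial] gives its value. *)
have ct0 : ct = 0 by rewrite -(is_cderive_cpartial dt).
have wline h : inner w (B *m (h *: v + x)) =
    inner w (B *m v) * h + inner w (B *m x).
  by rewrite mulmxDr -scalemxAr innerDr innerZr mulrC.
have dlhs := is_cderiveM (d1e (fun y => inner w (B *m y)) _ wline) dt.
rewrite ct0 ts0 mulr0 mul0r addr0 in dlhs.
have coord j h : (h *: v + x) j 0 = (j == l)%:R * h + x j 0.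
  by rewrite !mxE eqxx andbT mulrC.
have drhs : is_cderive x v
    (fun y => \sum_(j < d) S j (B *m y) * (1 - e2pii (y j 0)))
    (S l (B *m x) * - (0 +i* (2 * pi))%C).
  rewrite (_ : _ * _ = \sum_(j < d)
      S j (B *m x) * - (0 +i* (2 * pi * (j == l)%:R))%C).
    apply: is_cderive_sum => j.
    have [cS dS] := trigpoly_derivable B x v (tS j).
    have := is_cderiveM dS (d1e (fun y => y j 0) _ (coord j)).
    by rewrite mxE e2pii_int mul1r subrr mul0r addr0.
  rewrite (bigD1 l) //= big1 => [|j /negbTE ->].
    by rewrite eqxx mulr1 addr0.
  by rewrite mulr0 oppr0 mulr0.
have funE : (fun y => (1 - e2pii (inner w (B *m y))) * t (B *m y)) =
    (fun y => \sum_(j < d) S j (B *m y) * (1 - e2pii (y j 0))).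
  exact/funext.
rewrite funE in dlhs.
have /eqP := is_cderive_unique drhs dlhs.
rewrite mulf_eq0 => /orP[/eqP //|].
rewrite oppr_eq0 eq_complex /= eqxx /= mulf_eq0 pnatr_eq0 /=.
by rewrite (gt_eqF (pi_gt0 R)).
Qed.

End DivisionByPeriods.

Theorem theorem8 (R : realType) (d : nat) (M : 'M[int]_d)
    (D : set 'cV[int]_d) (t : 'cV[R]_d -> R[i])
    (T : 'I_d -> 'I_d -> 'cV[R]_d -> R[i])
    (hM : dilation R M) (hD : digits M^T D)
    (ht : classZ M D 1 t)
    (hT : forall j k, trigpoly (T j k))
    (hE : forall (k : 'I_d) (x : 'cV[R]_d),
        (1 - e2pii (inner x (unitvec R k))) * t x =
        \sum_(j < d) T j k x *
          (1 - e2pii (inner (castz M^T *m x) (unitvec R j)))) :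
  forall j k : 'I_d, classZ M D 0 (T j k).
Proof.
move=> l k; split; first exact: hT.
move=> s Ds s0 beta beta0.
have -> : beta = fun=> 0%N.
  apply/funext => j; apply/eqP; rewrite -leqn0.
  by apply: leq_trans beta0; rewrite (bigD1 j) //= leq_addr.
rewrite multiderive0.
have [tt tZ] := ht.
set B := invmx _ in tZ *.
have ABK y : castz M^T *m (B *m y) = y.
  rewrite /B mulKVmx // unitmxE det_map_mx det_tr unitfE intr_eq0.
  by case: hM.
apply: (coef_eq0_of_double_zero (B := B) (S := fun j => T j k)
  (w := unitvec R k) tt) => //.
- move=> y; have := hE k (B *m y); rewrite ABK innerC => ->.
  by apply: eq_bigr => j _; rewrite inner_unitvec.
- have := tZ s Ds s0 (fun=> 0%N); rewrite multiderive0; apply.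
  by rewrite big1.
(* The multi-index of [D_l] has order one, which [Z^1] allows. *)
- rewrite -multiderive1; apply: tZ => //.
  by rewrite (bigD1 l) //= eqxx big1 // => j /negbTE ->.
Qed.
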